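(* Let $\mathcal{U}=\{u_1,\dots,u_p\}\subset\mathbb{R}^3$ be a finite set and let $U$ be the $3\times p$ matrix with columns $u_1,\dots,u_p$. Then $\mathcal{U}$ is isometrically embeddable in $\mathbb{R}^3_{\geq 0}$ if and only if there exists a vector $g_1\in\mathbb{S}^2$ such that $$U^\top U\;\geq\;U^\top g_1g_1^\top U\;\geq\;0,$$ where the inequalities are entrywise.
   Context: $\mathbb{R}^3_{\geq 0}$ is the nonnegative octant, the set of vectors in $\mathbb{R}^3$ with all coordinates nonnegative. $\mathbb{S}^2$ is the Euclidean unit sphere in $\mathbb{R}^3$. A set $\mathcal{U}\subset\mathbb{R}^3$ is isometrically embeddable in $\mathbb{R}^3_{\geq 0}$ if there is an orthogonal matrix $Q\in\mathbb{R}^{3\times 3}$ with $Qu\in\mathbb{R}^3_{\geq 0}$ for all $u\in\mathcal{U}$; equivalently, if there is an orthonormal basis $f_1,f_2,f_3$ of $\mathbb{R}^3$ with $f_i^\top u\geq 0$ for all $i\in\{1,2,3\}$ and all $u\in\mathcal{U}$. Inequalities between matrices are meant entrywise. *)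

(* Defs.v *)
From mathcomp Require Import all_boot all_order all_algebra.
From mathcomp Require Import classical_sets reals.

Set Implicit Arguments.
Unset Strict Implicit.
Unset Printing Implicit Defensive.

Import Order.TTheory GRing.Theory Num.Theory.

Local Open Scope classical_set_scope.
Local Open Scope ring_scope.

Definition lemx (R : realType) (m n : nat) (A B : 'M[R]_(m, n)) : Prop :=
  forall i j, A i j <= B i j.

Definition nonneg_octant (R : realType) : set 'cV[R]_3 :=
  [set x | lemx 0 x].

(* The Euclidean norm is written out because the norm that MathComp-Analysis
   puts on matrices is the sup norm. *)
Definition sphere2 (R : realType) : set 'cV[R]_3 :=
  [set g | Num.sqrt (\sum_i g i 0 ^+ 2) = 1].

Definition orthogonal_mx (R : realType) (n : nat) (Q : 'M[R]_n) : Prop :=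
  Q^T *m Q = 1%:M.

Definition isometrically_embeddable (R : realType) (S : set 'cV[R]_3) : Prop :=
  exists2 Q : 'M[R]_3, orthogonal_mx Q &
    forall u, S u -> nonneg_octant (Q *m u).

Definition mx_of_cols (R : realType) (m p : nat) (u : 'I_p -> 'cV[R]_m) :
  'M[R]_(m, p) := \matrix_(i, j) u j i 0.

(* Main.v *)
Require Import Defs.
From mathcomp Require Import all_boot all_order all_algebra.
From mathcomp Require Import classical_sets reals.
From mathcomp Require Import ring lra.

(** Embedding [range u] means finding an orthonormal basis in which every
    [u i] has nonnegative coordinates.

    Such a basis gives [g1] as its first element: in its coordinates the inner
    product of [u i] and [u j] is a sum of three nonnegative products, and the
    first of them is the entry of [U^T *m g1 *m g1^T *m U].

    Conversely, the entries of [U^T *m g1 *m g1^T *m U] are the products of the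
    numbers [dot g1 (u i)].  Since they are nonnegative, these numbers do not
    change sign, and after replacing [g1] by its opposite if necessary they are
    all nonnegative; this settles the first coordinate.  The other hypothesis
    says that the projections of the [u i] to the plane orthogonal to [g1] have
    nonnegative pairwise inner products, i.e. make pairwise angles of at most a
    right angle.  Under this condition, counterclockwise precedence is a total
    preorder on the nonzero projections ([triple_trans]), so a finite family has
    a first direction ([first_direction]).  All the projections lie in the
    quadrant that starts counterclockwise from it, and [g1] completes the two
    edges of this quadrant to the required basis ([frame_of_direction]).

    The plane is never given coordinates.  The map [cross g] sends a vector to
    its projection rotated by a right angle, so the inner product of the
    projections of [x] and [y] is [dot (cross g x) (cross g y)], and the sine
    of the angle between them has the sign of [triple g x y]. *)

Import Order.TTheory GRing.Theory Num.Theory.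

Local Open Scope classical_set_scope.
Local Open Scope ring_scope.

(** * Inner and cross products in dimension three *)

Definition dot {R : realType} (x y : 'cV[R]_3) : R := \sum_k x k 0 * y k 0.

(** Indices are added modulo 3. *)
Definition cross {R : realType} (x y : 'cV[R]_3) : 'cV[R]_3 :=
  \col_k (x (k + 1) 0 * y (k + 2) 0 - x (k + 2) 0 * y (k + 1) 0).

Definition triple {R : realType} (x y z : 'cV[R]_3) : R := dot (cross x y) z.

Lemma dotE {R : realType} (x y : 'cV[R]_3) :
  dot x y = x 0 0 * y 0 0 + x 1 0 * y 1 0 + x 2 0 * y 2 0.
Proof.
rewrite /dot !big_ord_recl big_ord0 addr0 addrA.
by congr (_ + x _ _ * y _ _ + x _ _ * y _ _); apply: val_inj.
Qed.

Lemma crossE {R : realType} (x y : 'cV[R]_3) :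
  (cross x y 0 0 = x 1 0 * y 2 0 - x 2 0 * y 1 0) *
  (cross x y 1 0 = x 2 0 * y 0 0 - x 0 0 * y 2 0) *
  (cross x y 2 0 = x 0 0 * y 1 0 - x 1 0 * y 0 0).
Proof.
by split; [split|]; rewrite mxE; congr (x _ _ * y _ _ - x _ _ * y _ _);
  apply: val_inj.
Qed.

Lemma dotZr {R : realType} (a : R) (x y : 'cV[R]_3) :
  dot x (a *: y) = a * dot x y.
Proof. by rewrite !dotE !mxE; ring. Qed.

Lemma dotZl {R : realType} (a : R) (x y : 'cV[R]_3) :
  dot (a *: x) y = a * dot x y.
Proof. by rewrite !dotE !mxE; ring. Qed.

Lemma dotC {R : realType} (x y : 'cV[R]_3) : dot x y = dot y x.
Proof. by rewrite !dotE; ring. Qed.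

Lemma dot_ge0 {R : realType} (x : 'cV[R]_3) : 0 <= dot x x.
Proof. by apply: sumr_ge0 => k _; rewrite -expr2 sqr_ge0. Qed.

Lemma dot_eq0 {R : realType} (x : 'cV[R]_3) : dot x x = 0 -> x = 0.
Proof.
have ge0 k : true -> 0 <= x k 0 * x k 0 by rewrite -expr2 sqr_ge0.
move=> /eqP; rewrite /dot psumr_eq0 // => /allP xx0.
apply/colP => k; rewrite mxE; apply/eqP; rewrite -[_ == 0]orbb -mulf_eq0.
exact: xx0 (mem_index_enum k).
Qed.

(** The identity of Binet and Cauchy.  For a unit vector [g], the right-hand
    side is the inner product of the projections of [x] and [y] to the plane
    orthogonal to [g]. *)
Lemma dot_cross {R : realType} (g x y : 'cV[R]_3) :
  dot (cross g x) (cross g y) = dot g g * dot x y - dot g x * dot g y.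
Proof. by rewrite !dotE !crossE; ring. Qed.

Lemma sphere2P {R : realType} (g : 'cV[R]_3) : sphere2 g <-> dot g g = 1.
Proof.
have -> : dot g g = \sum_i g i 0 ^+ 2 by apply: eq_bigr => i _; rewrite expr2.
rewrite /sphere2 /=; split=> [n1|->]; last by rewrite sqrtr1.
by rewrite -[LHS]sqr_sqrtr ?n1 ?expr1n // sumr_ge0 // => i _; rewrite sqr_ge0.
Qed.

(** * The first direction of a family in the plane orthogonal to g *)

Lemma triple_alternate {R : realType} (g x y : 'cV[R]_3) :
  triple g x y = - triple g y x.
Proof. by rewrite /triple !dotE !crossE; ring. Qed.

(** This is the addition formula for the sine, applied to the angles from [v]
    to [w] and from [w] to [x] in the plane orthogonal to [g]. *)
Lemma triple_addition {R : realType} (g v w x : 'cV[R]_3) :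
  dot (cross g w) (cross g w) * triple g v x =
    dot (cross g v) (cross g w) * triple g w x +
    triple g v w * dot (cross g w) (cross g x).
Proof. by rewrite /triple !dotE !crossE; ring. Qed.

(** Counterclockwise precedence is transitive because both cosines are
    nonnegative in the addition formula. *)
Lemma triple_trans {R : realType} (g v w x : 'cV[R]_3) :
  0 < dot (cross g w) (cross g w) ->
  0 <= dot (cross g v) (cross g w) -> 0 <= dot (cross g w) (cross g x) ->
  0 <= triple g v w -> 0 <= triple g w x -> 0 <= triple g v x.
Proof.
move=> w_gt0 vw wx tvw twx.
by rewrite -(pmulr_rge0 _ w_gt0) triple_addition addr_ge0 // mulr_ge0.
Qed.

(** The squared lengths of the projections of the standard basis vectors add up
    to 2, so one of them is positive. *)
Lemma exists_not_collinear {R : realType} (g : 'cV[R]_3) :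
  dot g g = 1 -> exists w, 0 < dot (cross g w) (cross g w).
Proof.
move=> gg1; pose e k : 'cV[R]_3 := delta_mx k 0.
pose q k := dot (cross g (e k)) (cross g (e k)).
have sum_q : q 0 + q 1 + q 2 = 2.
  rewrite /q !dot_cross gg1 !dotE !mxE /=.
  move: gg1; rewrite dotE => gg1; nra.
have [q0|q0] := ltP 0 (q 0); first by exists (e 0).
have [q1|q1] := ltP 0 (q 1); first by exists (e 1).
by exists (e 2); rewrite -/(q 2); lra.
Qed.

(** The vector [w] is a least member of the family for counterclockwise
    precedence.  Only members with a nonzero projection are compared, because a
    zero projection precedes and follows everything and breaks transitivity.  If
    all the projections vanish, any [w] that is not collinear with [g] will
    do. *)
Lemma first_direction {R : realType} {p : nat} (u : 'I_p -> 'cV[R]_3)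
    (g : 'cV[R]_3) :
  dot g g = 1 ->
  (forall i j, 0 <= dot (cross g (u i)) (cross g (u j))) ->
  exists2 w, 0 < dot (cross g w) (cross g w) &
    forall i, 0 <= dot (cross g w) (cross g (u i)) /\ 0 <= triple g w (u i).
Proof.
move=> gg1 acute.
pose P i := 0 < dot (cross g (u i)) (cross g (u i)).
have proj0 i : ~~ P i -> cross g (u i) = 0.
  rewrite /P -leNgt => le0; apply: dot_eq0; apply/eqP.
  by rewrite eq_le le0 dot_ge0.
have triple0 w i : ~~ P i -> triple g w (u i) = 0.
  move=> /proj0 ui0; rewrite triple_alternate /triple ui0.
  by rewrite dotE !mxE !mul0r !addr0 oppr0.
have [i0 Pi0|noP] := pickP P; last first.
  have [w w_gt0] := exists_not_collinear _ gg1; exists w => // i.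
  have nPi : ~~ P i by rewrite noP.
  by rewrite (triple0 _ _ nPi) (proj0 _ nPi) dotC dotE !mxE !mul0r !addr0.
pose before : rel 'I_p := fun i j => 0 <= triple g (u i) (u j).
have refl : {in P, reflexive before}.
  move=> i _; rewrite /before; have := triple_alternate g (u i) (u i); lra.
have trans : {in P & P & P, transitive before}.
  by move=> j i k Pj _ _; apply: triple_trans.
have total : {in P &, total before}.
  move=> i j _ _; rewrite /before (triple_alternate _ _ (u j)) oppr_ge0.
  by case: ltgtP.
have [m Pm m_first] := @extremum_inP _ _ before i0 P id refl trans total Pi0.
exists (u m) => // i; split; first exact: acute.
by have [Pi|/triple0 ->] := boolP (P i); first exact: m_first.
Qed.

(** * From the first direction to an orthonormal basis *)

(** The rows are [g], the normalized projection of [w] to the plane orthogonal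
    to [g], and the rotation of the latter by a right angle about [g]. *)
Lemma frame_of_direction {R : realType} (g w : 'cV[R]_3) :
  dot g g = 1 -> 0 < dot (cross g w) (cross g w) ->
  exists2 Q : 'M[R]_3, orthogonal_mx Q &
    forall x, 0 <= dot g x -> 0 <= dot (cross g w) (cross g x) ->
      0 <= triple g w x -> nonneg_octant (Q *m x).
Proof.
move=> gg1 w_gt0; set c := dot _ _ in w_gt0.
pose s := (Num.sqrt c)^-1.
have s_ge0 : 0 <= s by rewrite invr_ge0 sqrtr_ge0.
have ssc : s * s * c = 1.
  by rewrite -expr2 exprVn sqr_sqrtr ?ltW // mulVf ?gt_eqF.
pose f (i : 'I_3) :=
  tnth [tuple g; s *: cross (cross g w) g; s *: cross g w] i.
pose Q : 'M[R]_3 := \matrix_(i, j) f i j 0.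
have QE x i : (Q *m x) i 0 = dot (f i) x.
  by rewrite mxE; apply: eq_bigr => k _; rewrite mxE.
have projE x : dot (cross (cross g w) g) x = dot (cross g w) (cross g x).
  by rewrite !dotE !crossE; ring.
exists Q.
  apply: mulmx1C; apply/matrixP => i j.
  have -> : (Q *m Q^T) i j = dot (f i) (f j).
    by rewrite mxE; apply: eq_bigr => k _; rewrite !mxE.
  have g_proj : dot g (cross (cross g w) g) = 0.
    by rewrite !dotE !crossE; ring.
  have g_rot : dot g (cross g w) = 0 by rewrite !dotE !crossE; ring.
  have proj_rot : dot (cross (cross g w) g) (cross g w) = 0.
    by rewrite !dotE !crossE; ring.
  have proj_proj : dot (cross (cross g w) g) (cross (cross g w) g) = c.
    have -> : c = dot g g * c by rewrite gg1 mul1r.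
    by rewrite /c !dotE !crossE; ring.
  rewrite mxE; case: i j => [[|[|[|//]]] ?] [[|[|[|//]]] ?];
    rewrite /f !(tnth_nth 0) /= ?dotZl ?dotZr ?gg1 ?g_proj ?g_rot ?proj_rot
      ?proj_proj -?/c ?mulrA ?ssc ?mulr0 //;
    by rewrite dotC ?g_proj ?g_rot ?proj_rot ?mulr0.
move=> x gx wx tx i k; rewrite [k]ord1 mxE QE.
case: i => [[|[|[|//]]] ?]; rewrite /f (tnth_nth 0) //= dotZl mulr_ge0 //.
by rewrite projE.
Qed.

(** * The entries of the two matrices *)

Lemma gram_entry {R : realType} {p : nat} (u : 'I_p -> 'cV[R]_3) i j :
  ((mx_of_cols u)^T *m mx_of_cols u) i j = dot (u i) (u j).
Proof. by rewrite mxE; apply: eq_bigr => k _; rewrite !mxE. Qed.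

Lemma rank1_entry {R : realType} {p : nat} (u : 'I_p -> 'cV[R]_3)
    (g : 'cV[R]_3) i j :
  ((mx_of_cols u)^T *m g *m g^T *m mx_of_cols u) i j =
    dot g (u i) * dot g (u j).
Proof.
rewrite -mulmxA mxE big_ord1; congr (_ * _); rewrite mxE;
  by apply: eq_bigr => k _; rewrite !mxE // mulrC.
Qed.

(** A negative member makes every other member nonpositive, so the whole family
    can be reflected. *)
Lemma constant_sign {R : realType} {I : finType} (a : I -> R) :
  (forall i j, 0 <= a i * a j) ->
  exists2 e : R, e * e = 1 & forall i, 0 <= e * a i.
Proof.
move=> aa; have [i0 neg|nonneg] := pickP (fun i => a i < 0).
  exists (-1); first by rewrite mulrNN mulr1.
  by move=> i; rewrite mulN1r oppr_ge0 -(nmulr_rge0 _ neg).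
by exists 1 => [|i]; rewrite mul1r // leNgt nonneg.
Qed.

Theorem theorem1p4 (R : realType) (p : nat) (u : 'I_p -> 'cV[R]_3) :
  let U : 'M[R]_(3, p) := mx_of_cols u in
  isometrically_embeddable (range u) <->
  exists g1 : 'cV[R]_3, sphere2 g1 /\
    lemx (U^T *m g1 *m g1^T *m U) (U^T *m U) /\
    lemx 0 (U^T *m g1 *m g1^T *m U).
Proof.
move=> U; split.
  move=> [Q Qorth Qu].
  have Q_ge0 i k : 0 <= (Q *m u i) k 0.
    by have := Qu (u i) (ex_intro2 _ _ i I erefl) k 0; rewrite mxE.
  have QQT : Q *m Q^T = 1%:M by apply: mulmx1C.
  pose g : 'cV[R]_3 := (row 0 Q)^T.
  have gE x : dot g x = (Q *m x) 0 0.
    by rewrite mxE; apply: eq_bigr => k _; rewrite !mxE.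
  exists g; split; [|split=> i j].
  - apply/sphere2P; rewrite gE; transitivity ((Q *m Q^T) 0 0).
      by rewrite !mxE; apply: eq_bigr => k _; rewrite !mxE.
    by rewrite QQT mxE.
  - rewrite rank1_entry gram_entry !gE.
    have -> : dot (u i) (u j) = dot (Q *m u i) (Q *m u j).
      have dot_mx x y : dot x y = (x^T *m y) 0 0 :> R.
        by rewrite mxE; apply: eq_bigr => k _; rewrite mxE.
      by rewrite !dot_mx trmx_mul mulmxA -(mulmxA _ Q^T) Qorth mulmx1.
    by rewrite dotE -addrA lerDl addr_ge0 // mulr_ge0.
  - by rewrite rank1_entry !gE mxE mulr_ge0.
move=> [g [/sphere2P gg1 [le_gram ge0]]].
have [i j|e ee1 eg_ge0] := constant_sign (fun i => dot g (u i)).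
  by have := ge0 i j; rewrite mxE rank1_entry.
have hh1 : dot (e *: g) (e *: g) = 1 by rewrite dotZl dotZr mulrA ee1 mul1r.
have [i j|w w_gt0 w_first] := first_direction u _ hh1.
  rewrite dot_cross hh1 mul1r !dotZl mulrACA ee1 mul1r subr_ge0.
  by have := le_gram i j; rewrite rank1_entry gram_entry.
have [Q Qorth Q_octant] := frame_of_direction _ _ hh1 w_gt0.
exists Q => // _ [i _ <-]; have [wu tu] := w_first i.
by apply: Q_octant => //; rewrite dotZl.
Qed.
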